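(* Let $r\ge 1$ and $n\ge 1$ be integers. Then $$\sum_{\nu\in\mathfrak{S}^{(r)}_{n}}q^{\mathrm{INV}(\nu)}=\sum_{\nu\in\mathfrak{S}^{(r)}_{n}}q^{\mathrm{MAJ}(\nu)}=[r+1][2r+1]\cdots[(n-1)r+1].$$
   Context: For $m\ge 0$, $[m]:=\sum_{i=0}^{m-1}q^{i}$. An $r$-Stirling permutation of size $n$ is a word $\nu=\nu_1\cdots\nu_{rn}$ which is a rearrangement of the multiset $\{1^r,2^r,\ldots,n^r\}$ (each of $1,\ldots,n$ occurs exactly $r$ times) such that every entry $i$ lying between two occurrences of $j$ satisfies $i\le j$ (i.e. entries different from $j$ lying between two $j$'s are smaller than $j$). $\mathfrak{S}^{(r)}_n$ is the set of $r$-Stirling permutations of size $n$. For $\nu\in\mathfrak{S}^{(r)}_n$, $\mathrm{inv}(\nu)$ is the number of pairs $(j,k)$ with $1\le j<k\le rn$ and $\nu_j>\nu_k$, and $\mathrm{INV}(\nu):=\frac1r\mathrm{inv}(\nu)$. Further $$\mathrm{MAJ}(\nu):=\sum_{j\in J(\nu)}j,\qquad J(\nu):=\{1\le j\le r(n-1):\ \nu_j>\nu_{j+1}=\nu_{j+2}=\cdots=\nu_{j+r}\}.$$ The empty product (case $n=1$) is $1$. *)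

(* Defs.v *)
From HB Require Import structures.
From mathcomp Require Import all_boot all_order all_algebra.

Set Implicit Arguments.
Unset Strict Implicit.
Unset Printing Implicit Defensive.

Import GRing.Theory.
Local Open Scope nat_scope.

(* A word is a [seq nat].  The paper's [nu_j] (positions starting at 1) is
   [nth 0 nu j.-1]. *)

Definition stirling_multiset (r n : nat) : seq nat :=
  flatten [seq nseq r i | i <- iota 1 n].

Definition stirling_cond (nu : seq nat) : bool :=
  [forall a : 'I_(size nu), forall b : 'I_(size nu), forall c : 'I_(size nu),
     (a < b < c) && (nth 0 nu a == nth 0 nu c) ==> (nth 0 nu b <= nth 0 nu a)].

(* [permutations] lists the rearrangements of a multiset without repetition. *)
Definition stirling_perms (r n : nat) : seq (seq nat) :=
  [seq nu <- permutations (stirling_multiset r n) | stirling_cond nu].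

Definition inv (nu : seq nat) : nat :=
  #|[set p : 'I_(size nu) * 'I_(size nu) |
      (p.1 < p.2) && (nth 0 nu p.1 > nth 0 nu p.2)]|.

(* The division is exact on r-Stirling permutations: see [INV_exact]. *)
Definition INV (r : nat) (nu : seq nat) : nat := inv nu %/ r.

(* j \in J(nu) iff 1 <= j <= r (n - 1) and [Jpos r nu j]; j is a 1-based position. *)
Definition Jpos (r : nat) (nu : seq nat) (j : nat) : bool :=
  (nth 0 nu j.-1 > nth 0 nu j) &&
  [forall k : 'I_r, nth 0 nu (j + k) == nth 0 nu j].

Definition MAJ (r n : nat) (nu : seq nat) : nat :=
  \sum_(1 <= j < (r * (n - 1)).+1 | Jpos r nu j) j.

Definition qint (m : nat) : {poly int} := (\sum_(i < m) 'X^i)%R.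

Lemma count_stirling_multiset r n i :
  count_mem i (stirling_multiset r n) = r * (i \in iota 1 n).
Proof.
rewrite /stirling_multiset; move: (iota_uniq 1 n).
elim: (iota 1 n) => [|x s IH] /= => [_|/andP[xs us]]; first by rewrite muln0.
rewrite count_cat IH // count_nseq /= inE eq_sym.
by case: eqP => [->|_] /=; rewrite ?(negbTE xs) ?muln0 ?addn0 ?mul1n ?muln1.
Qed.

Lemma INV_exact r n nu : nu \in stirling_perms r n -> INV r nu * r = inv nu.
Proof.
rewrite mem_filter mem_permutations => /andP[/forallP st pe].
rewrite divnK //.
pose c (k : 'I_(size nu)) :=
  #|[pred j : 'I_(size nu) | (j < k) && (nth 0 nu j > nth 0 nu k)]|.
have -> : inv nu = \sum_k c k.
  rewrite /inv -sum1dep_card.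
  rewrite -(pair_big_dep xpredT (fun j k : 'I_(size nu) =>
    (j < k) && (nth 0 nu k < nth 0 nu j)) (fun _ _ => 1)) /=.
  rewrite (exchange_big_dep xpredT) //=.
  by apply: eq_bigr => k _; rewrite /c -sum1_card.
have cle (k l : 'I_(size nu)) : k < l -> nth 0 nu k = nth 0 nu l -> c k = c l.
  move=> kl e; apply: eq_card => j; rewrite !inE e.
  case: (ltngtP j k) => jk /=.
  - by rewrite (ltn_trans jk kl).
  - case: (boolP (j < l)) => //= jl; apply/esym/negbTE; rewrite -leqNgt -e.
    by move/forallP: (st k) => /(_ j)/forallP/(_ l); rewrite jk jl e eqxx.
  - by rewrite (val_inj jk) e ltnn andbF.
have ceq (k l : 'I_(size nu)) : nth 0 nu k = nth 0 nu l -> c k = c l.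
  by move=> e; case: (ltngtP k l) => [/cle->//|/cle->//|/val_inj->].
pose M := \max_(k < size nu) nth 0 nu k.
have hM (k : 'I_(size nu)) : nth 0 nu k < M.+1 by rewrite ltnS (leq_bigmax k).
rewrite (partition_big (fun k => Ordinal (hM k)) xpredT) //=.
apply: dvdn_sum => i _.
have card_i : #|[pred k : 'I_(size nu) | Ordinal (hM k) == i]| = count_mem (val i) nu.
  rewrite -sum1_card -sum1_count (big_nth 0) big_mkord.
  by apply: eq_bigl => k; rewrite !inE.
case: (pickP [pred k : 'I_(size nu) | Ordinal (hM k) == i]) => [k0 /= k0i|no];
  last by rewrite big_pred0.
rewrite (eq_bigr (fun _ => c k0)) => [|k ki].
  rewrite sum_nat_const card_i (permP pe) count_stirling_multiset.
  by rewrite -mulnA dvdn_mulr.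
by apply: ceq; move: (eqP ki) (eqP k0i) => <- [].
Qed.

(* Main.v *)
Require Import Defs.
From mathcomp Require Import all_boot all_order all_algebra.
From mathcomp Require Import zify.

Import GRing.Theory.
Local Open Scope ring_scope.

(** In an r-Stirling word nothing but a 1 may stand between two 1s, so the r
    copies of the smallest letter form one contiguous block.  Deleting that
    block and lowering the other letters by 1 leaves an r-Stirling word of size
    n - 1; conversely the block can be put back at any of the r(n-1) + 1 places
    of such a word, independently of its shape ([perm_stirling_permsS]).  It is
    therefore enough that, for each word s of size n, inserting the block in all
    possible ways multiplies q^stat(s) by [rn + 1]; the product formula follows
    by induction ([insertion_statistic]).

    For INV this is immediate: a block of 1s placed after p letters creates rp
    inversions, that is, INV grows by p ([inv_insert_min]).

    For MAJ, let J be the set of counted positions of s.  The block always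
    creates the position p (if p > 0), moves the positions j > p to j + r, leaves
    those with j + r <= p alone, and destroys the j with j <= p < j + r, whose
    run of r equal letters is cut, or separated from the letter before it
    ([Jpos_insert_min], [MAJ_insert_min]).  The windows [j, j + r) with j in J
    are pairwise disjoint ([Jpos_gap]).  Reading the places p from left to right,
    a window at a time, the values of MAJ obtained so far always fill an
    interval: a place outside all windows adds the next value above it, and the
    r places of a whole window add the r values just below it
    ([insertion_interval]).  After all rn + 1 places the interval starts at
    MAJ(s), whence the factor [rn + 1]. *)

Local Open Scope nat_scope.

(** * Inserting the block of smallest letters *)

Definition insert_min (r p : nat) (s : seq nat) : seq nat :=
  map S (take p s) ++ nseq r 1%N ++ map S (drop p s).

Lemma size_insert_min r p s : size (insert_min r p s) = size s + r.
Proof.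
by rewrite /insert_min !size_cat !size_map size_nseq addnCA -size_cat cat_take_drop addnC.
Qed.

Lemma nth_insert_min r p s i : p <= size s -> i < size s + r ->
  nth 0 (insert_min r p s) i =
    if i < p then (nth 0 s i).+1
    else if i < p + r then 1 else (nth 0 s (i - r)).+1.
Proof.
move=> lep lti; rewrite /insert_min !nth_cat size_map size_takel // size_nseq.
case: ltnP => ip; first by rewrite (nth_map 0) ?size_takel ?nth_take.
rewrite ltn_subLR // nth_nseq ltn_subLR //; case: ltnP => // ipr.
rewrite (nth_map 0) ?size_drop; last by lia.
by rewrite nth_drop; congr (nth _ _ _).+1; lia.
Qed.

Lemma stirling_condP (s : seq nat) :
  reflect (forall a b c, a < b -> b < c -> c < size s ->
             nth 0 s a = nth 0 s c -> nth 0 s b <= nth 0 s a)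
          (stirling_cond s).
Proof.
apply: (iffP idP) => [/forallP st a b c ab bc cs e|st].
  have bs := ltn_trans bc cs; have as_ := ltn_trans ab bs.
  move/forallP: (st (Ordinal as_)) => /(_ (Ordinal bs))/forallP/(_ (Ordinal cs)) /=.
  by rewrite ab bc e eqxx.
apply/forallP=> a; apply/forallP=> b; apply/forallP=> c.
by apply/implyP=> /andP[/andP[ab bc] /eqP e]; apply: (st a b c).
Qed.

Lemma nth_gt0 (s : seq nat) i : 0 \notin s -> i < size s -> 0 < nth 0 s i.
Proof. by move=> s0 /(mem_nth 0); case: (nth 0 s i) => // ; rewrite (negPf s0). Qed.

(** The inserted letters are the smallest and adjacent to each other, so they
    take part in no forbidden pattern; positivity of the letters of [s] is what
    makes the shifted letters differ from the inserted 1s. *)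
Lemma stirling_cond_insert_min r p (s : seq nat) : 0 \notin s -> p <= size s ->
  stirling_cond (insert_min r p s) = stirling_cond s.
Proof.
move=> s0 lep; apply/stirling_condP/stirling_condP => st a b c ab bc;
  last rewrite size_insert_min; move=> cs.
  (* [l i] is the place to which the insertion moves place [i]. *)
  pose l i := if i < p then i else i + r.
  have nl i : i < size s -> nth 0 (insert_min r p s) (l i) = (nth 0 s i).+1.
    move=> lt_is; rewrite nth_insert_min //; last by rewrite /l; case: ifP; lia.
    rewrite /l; case: (ltnP i p) => [->//|ip].
    by rewrite !ifF ?addnK //; lia.
  have ll i j : i < j -> l i < l j by rewrite /l; do 2! case: ifP; lia.
  move=> e; have := st (l a) (l b) (l c) (ll _ _ ab) (ll _ _ bc).
  rewrite !nl ?size_insert_min; [|lia..].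
  by rewrite e; apply=> //; rewrite /l; case: ifP; lia.
have bs : b < size s + r by lia.
have as_ : a < size s + r by lia.
rewrite !nth_insert_min //.
have pos i : i < size s -> 0 < nth 0 s i by apply: nth_gt0.
case: (ltnP a p) => ap; last case: (ltnP a (p + r)) => apr.
- case: (ltnP b p) => bp; last case: (ltnP b (p + r)) => // bpr.
  + case: (ltnP c p) => cp; last case: (ltnP c (p + r)) => cpr.
    * by move=> [e]; rewrite ltnS; apply: (st a b c) => //; lia.
    * by have := pos a; lia.
    * by move=> [e]; rewrite ltnS; apply: (st a b (c - r)) => //; lia.
  + rewrite !ifF; [|lia..] => -[e].
    by rewrite ltnS; apply: (st a (b - r) (c - r)) => //; lia.
- have [cp bp] : (c < p) = false /\ (b < p) = false by lia.
  rewrite cp bp.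
  case: (ltnP c (p + r)) => cpr; last by have := pos (c - r); lia.
  by rewrite ifT //; lia.
- rewrite !ifF; [|lia..] => -[e].
  by rewrite ltnS; apply: (st (a - r) (b - r) (c - r)) => //; lia.
Qed.

Lemma stirling_multisetS r n :
  stirling_multiset r n.+1 = nseq r 1 ++ map S (stirling_multiset r n).
Proof.
rewrite /stirling_multiset /= (iotaDl 1 1) -map_comp map_flatten -map_comp.
by congr (_ ++ flatten _); apply: eq_map => i /=; rewrite map_nseq.
Qed.

Lemma perm_insert_min r p s : perm_eq (insert_min r p s) (nseq r 1 ++ map S s).
Proof. by rewrite perm_catCA perm_cat2l -map_cat cat_take_drop. Qed.

Lemma stirling_multiset0 r n : 0 \notin stirling_multiset r n.
Proof.
apply/negP => /flattenP[_ /mapP[i + ->]].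
by rewrite mem_iota mem_nseq => /andP[i1 _] /andP[_ /eqP i0]; rewrite -i0 in i1.
Qed.

Lemma mem_stirling_perms r n (nu : seq nat) : nu \in stirling_perms r n ->
  [/\ 0 \notin nu, size nu = r * n & stirling_cond nu].
Proof.
rewrite mem_filter mem_permutations => /andP[st pe]; split=> //.
  by rewrite (perm_mem pe) stirling_multiset0.
rewrite (perm_size pe) {pe}; elim: n => [|n IH]; first by rewrite muln0.
by rewrite stirling_multisetS size_cat size_nseq size_map IH mulnS.
Qed.

(** Both data can be read off the word: the insertion place is the index of the
    first 1, and the other letters are those different from 1. *)
Lemma insert_min_inj r n p q s t : 0 < r ->
  s \in stirling_perms r n -> t \in stirling_perms r n ->
  p <= r * n -> q <= r * n ->
  insert_min r p s = insert_min r q t -> s = t /\ p = q.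
Proof.
move=> r0 /mem_stirling_perms[s0 zs _] /mem_stirling_perms[t0 zt _].
rewrite -{1}zs -zt => ps qt e.
have n1 (u : seq nat) : 0 \notin u -> 1 \notin map S u.
  by move=> u0; rewrite (mem_map succn_inj).
have filt p' u : 0 \notin u -> filter (predC1 1) (insert_min r p' u) = map S u.
  move=> u0; rewrite /insert_min !filter_cat filter_nseq /= -filter_cat -map_cat cat_take_drop.
  by apply/all_filterP/allP => x xu; apply: contraTneq xu => -> /=; apply: n1.
have idx p' u : 0 \notin u -> p' <= size u -> index 1 (insert_min r p' u) = p'.
  move=> u0 pu; rewrite /insert_min index_cat ifF.
    by case: (r) r0 => //= k _; rewrite addn0 size_map size_takel.
  by apply/negbTE/n1; apply: contraNN u0; apply: mem_take.
split; last by rewrite -(idx p s) // e idx.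
by apply: (inj_map succn_inj); rewrite -(filt p s) // e filt.
Qed.

(** The word is cut at its first 1 as [take p nu ++ nseq k 1 ++ v], with [k]
    maximal; a 1 inside [v] would enclose the head of [v], which exceeds 1, so
    all r copies of 1 lie in the middle part. *)
Lemma insert_min_surj r n (nu : seq nat) : 0 < r -> nu \in stirling_perms r n.+1 ->
  exists p s, [/\ s \in stirling_perms r n, p <= r * n & nu = insert_min r p s].
Proof.
move=> r0 nuS; have [nu0 zn _] := mem_stirling_perms _ _ _ nuS.
move: nuS; rewrite mem_filter mem_permutations stirling_multisetS => /andP[st pe].
pose p := index 1 nu.
have nu1 : 1 \in nu by rewrite (perm_mem pe) mem_cat mem_nseq r0.
have lead_ones (u : seq nat) : exists k v, u = nseq k 1 ++ v /\ nth 0 v 0 != 1.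
  elim: u => [|x u [k [v [-> hv]]]]; first by exists 0, [::].
  case: (eqVneq x 1) => [->|x1]; first by exists k.+1, v.
  by exists 0, (x :: nseq k 1 ++ v).
have [k [v [euv hv]]] := lead_ones (drop p nu).
have A1 : 1 \notin take p nu by rewrite in_take_leq ?ltnn // index_size.
have enu : nu = take p nu ++ nseq k 1 ++ v by rewrite -euv cat_take_drop.
have pn : p < size nu by rewrite index_mem.
have sA : size (take p nu) = p by rewrite size_takel // ltnW.
have k0 : 0 < k.
  case: k euv enu => // euv enu; move: hv; rewrite -[v]/(nseq 0 1 ++ v) -euv nth_drop addn0.
  by rewrite nth_index.
have v1 : 1 \notin v.
  apply/negP => /(nthP 0)[i iv vi].
  have i0 : 0 < i by case: i vi {iv} => // vi; rewrite vi in hv.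
  have nv j : nth 0 nu (p + k + j) = nth 0 v j.
    by rewrite enu !nth_cat sA size_nseq !ifF ?[in LHS]subnDA; [congr nth|..]; lia.
  have v0 : nth 0 v 0 \in nu by rewrite enu !mem_cat mem_nth ?orbT //; lia.
  (* The 1s at places [p] and [p + k + i] enclose the head of [v]. *)
  have zv : size nu = p + k + size v by rewrite enu !size_cat sA size_nseq addnA.
  have : nth 0 nu (p + k + 0) <= nth 0 nu p.
    apply: (stirling_condP _ st p (p + k + 0) (p + k + i)); [lia|lia|by rewrite zv ltn_add2l|].
    by rewrite nv vi nth_index.
  rewrite nv nth_index //; have := nth_gt0 _ 0 nu0; move: hv v0.
  by case: (nth 0 v 0) => [|[|x]] //; rewrite (negPf nu0).
have m1 : 1 \notin map S (stirling_multiset r n).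
  by rewrite (mem_map succn_inj) stirling_multiset0.
have kr : k = r.
  have /permP/(_ (pred1 1)) := pe; rewrite {1}enu !count_cat !count_nseq /= !mul1n.
  by rewrite (count_memPn A1) (count_memPn v1) (count_memPn m1); lia.
subst k.
pose s := map predn (take p nu ++ v).
have Ss : map S s = take p nu ++ v.
  rewrite /s -map_comp -[RHS]map_id; apply/eq_in_map => -[|x] // x0; exfalso.
  move/negP: nu0; apply; rewrite enu !mem_cat.
  by move: x0; rewrite mem_cat => /orP[] ->; rewrite ?orbT.
have ei : nu = insert_min r p s.
  rewrite /insert_min map_take map_drop Ss take_size_cat // drop_size_cat //.
have es : perm_eq s (stirling_multiset r n).
  apply: (perm_map_inj succn_inj); rewrite -(perm_cat2l (nseq r 1)).
  by rewrite -(permPl (perm_insert_min r p s)) -ei.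
have zs : size s = r * n.
  by have := size_insert_min r p s; rewrite -ei zn mulnS; lia.
have ps : p <= size s by rewrite /s size_map size_cat sA leq_addr.
exists p, s; split; [|by rewrite -zs|by []].
rewrite mem_filter mem_permutations es andbT.
by rewrite -(stirling_cond_insert_min r p) -?ei // (perm_mem es) stirling_multiset0.
Qed.

Lemma mem_insert_min r n p s : s \in stirling_perms r n -> p <= r * n ->
  insert_min r p s \in stirling_perms r n.+1.
Proof.
move=> sS pn; have [s0 zs st] := mem_stirling_perms _ _ _ sS.
move: sS; rewrite !mem_filter !mem_permutations => /andP[_ es].
rewrite stirling_cond_insert_min ?zs // st stirling_multisetS.
by rewrite (permPl (perm_insert_min r p s)) perm_cat2l perm_map.
Qed.

Lemma perm_stirling_permsS r n : 0 < r ->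
  perm_eq (stirling_perms r n.+1)
    [seq insert_min r p s | s <- stirling_perms r n, p <- iota 0 (r * n).+1].
Proof.
move=> r0; have un m : uniq (stirling_perms r m).
  exact: filter_uniq (permutations_uniq _).
apply: uniq_perm => // [|nu].
  apply: allpairs_uniq => //; first exact: iota_uniq.
  move=> [s p] [t q] /allpairsPdep[s' [p' [ss pp [-> ->]]]].
  move=> /allpairsPdep[t' [q' [tt qq [-> ->]]]] /= e.
  rewrite !mem_iota /= !ltnS in pp qq.
  by have [-> ->] := insert_min_inj r n p' q' s' t' r0 ss tt pp qq e.
apply/idP/allpairsPdep => [/(insert_min_surj _ _ _ r0)[p [s [ss ps ->]]]|].
  by exists s, p; rewrite mem_iota ltnS.
move=> [s [p [ss + ->]]]; rewrite mem_iota ltnS; exact: mem_insert_min.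
Qed.

(** The common frame of the two computations: only the effect of the insertions
    on a single word remains to be found.  The recursion starts from the empty
    word rather than from n = 1, whence the trivial factor for i = 0. *)
Lemma insertion_statistic r (stat : nat -> seq nat -> nat) : 0 < r ->
  stat 0 [::] = 0 ->
  (forall n s, s \in stirling_perms r n ->
    \sum_(0 <= p < (r * n).+1) 'X^(stat n.+1 (insert_min r p s))
      = 'X^(stat n s) * qint (n * r + 1) :> {poly int})%R ->
  forall n, (\sum_(nu <- stirling_perms r n) 'X^(stat n nu)
    = \prod_(0 <= i < n) qint (i * r + 1) :> {poly int})%R.
Proof.
move=> r0 stat0 step; elim=> [|n IH].
  have -> : stirling_perms r 0 = [:: [::]].
    rewrite /stirling_perms /= (_ : stirling_cond [::]) //.
    by apply/forallP => -[].
  by rewrite big_seq1 big_geq // stat0.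
rewrite (perm_big _ (perm_stirling_permsS r n r0)) big_allpairs_dep /= big_nat_recr //=.
rewrite -IH mulr_suml big_seq [RHS]big_seq; apply: eq_bigr => s sS.
by rewrite -step // /index_iota subn0.
Qed.

(** * Inversions *)

(** Counting inversions by their left letter makes the effect of an insertion
    accessible to induction on the word. *)
Fixpoint inv_rec (s : seq nat) : nat :=
  if s is x :: s' then count (fun y => y < x) s' + inv_rec s' else 0.

Lemma invE s : Defs.inv s = inv_rec s.
Proof.
have invS (t : seq nat) : Defs.inv t = \sum_(i < size t) \sum_(j < size t)
    ((i < j) && (nth 0 t j < nth 0 t i)).
  rewrite /Defs.inv -sum1dep_card pair_big big_mkcond /=.
  by apply: eq_bigr => -[i j] _ /=; case: (_ && _).
rewrite invS; elim: s => [|x s IH] /=; first by rewrite big_ord0.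
rewrite big_ord_recl /= big_ord_recl /= add0n; congr (_ + _).
  rewrite -sum1_count (big_nth 0) big_mkord [RHS]big_mkcond.
  by apply: eq_bigr => i _; rewrite /=; case: (_ < _).
by rewrite -IH; apply: eq_bigr => i _; rewrite big_ord_recl.
Qed.

Lemma inv_rec_ones r s : inv_rec (nseq r 1 ++ map S s) = inv_rec s.
Proof.
elim: r => [|r IH] /=.
  by elim: s => //= x s ->; rewrite count_map; congr (_ + _); apply: eq_count.
rewrite IH count_cat count_nseq /= count_map (eq_count (a2 := pred0)) //.
by rewrite count_pred0.
Qed.

Lemma inv_insert_min r p (s : seq nat) : 0 \notin s -> p <= size s ->
  Defs.inv (insert_min r p s) = p * r + Defs.inv s.
Proof.
rewrite !invE /insert_min; elim: s p => [|x s IH] [|p] //= s0 ps.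
- by rewrite (inv_rec_ones r [::]).
- by rewrite (inv_rec_ones r (x :: s)).
move: s0; rewrite inE negb_or => /andP[x0 s0]; rewrite IH //.
rewrite !count_cat count_nseq /= ltnS lt0n eq_sym x0 mul1n mulSn.
have -> : count (fun y => y < x) s = count (fun y => y < x.+1) (map S (take p s))
    + count (fun y => y < x.+1) (map S (drop p s)).
  by rewrite -count_cat -map_cat cat_take_drop count_map; apply: eq_count.
lia.
Qed.

(** * The major index *)

(** Between two counted positions there is room for a whole run: the letters
    after position i are equal for r places, so no descent can occur there. *)
Lemma Jpos_gap r nu i j : Jpos r nu i -> Jpos r nu j -> 0 < j -> i < j -> i + r <= j.
Proof.
move=> /andP[_ /forallP Ji] /andP[dj _] j0 ij; rewrite leqNgt; apply/negP=> jr.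
have at_i k : i <= k -> k < i + r -> nth 0 nu k = nth 0 nu i.
  move=> ik kr; have kr' : k - i < r by lia.
  by rewrite -(eqP (Ji (Ordinal kr'))) /= subnKC.
by move: dj; rewrite !at_i ?ltnn; lia.
Qed.

(** Old positions survive exactly when the block does not fall into their window;
    a descent into the block appears at [p] (for p = j it takes the place of the
    one that is lost), and none leaves it. *)
Lemma Jpos_insert_min r p (s : seq nat) j : 0 < r -> 0 \notin s ->
  p <= size s -> 0 < j -> j <= size s ->
  Jpos r (insert_min r p s) j =
    [|| j == p, (j + r <= p) && Jpos r s j | (p + r < j) && Jpos r s (j - r)].
Proof.
move=> r0 s0 ps j0 js.
have nE i : i < size s + r -> nth 0 (insert_min r p s) i =
    if i < p then (nth 0 s i).+1
    else if i < p + r then 1 else (nth 0 s (i - r)).+1 by apply: nth_insert_min.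
case: (eqVneq j p) => [ejp|njp] /=.
  apply/andP; split.
    have [e1 e2 e3] : [/\ j < p = false, j < p + r = true & j.-1 < p = true] by split; lia.
    by rewrite !nE ?e1 ?e2 ?e3 ?ltnS ?nth_gt0 //; lia.
  apply/forallP=> k; have kr := ltn_ord k.
  have [e1 e2 e3] : [/\ (p + k < p) = false, p + k < p + r & p < p + r] by split; lia.
  by rewrite ejp !nE ?e1 ?e2 ?e3 ?ltnn //; lia.
case: (leqP (j + r) p) => jp /=.
  rewrite ltnNge (_ : j <= p + r) /=; last by lia.
  rewrite orbF /Jpos !nE; [|lia..]; rewrite !ifT ?ltnS; [|lia..].
  congr (_ && _); apply: eq_forallb => k; have kr := ltn_ord k.
  by rewrite nE ?ifT; lia.
case: (ltnP (p + r) j) => pj /=.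
  rewrite /Jpos !nE; [|lia..]; rewrite !ifF ?ltnS; [|lia..].
  rewrite (_ : j.-1 - r = (j - r).-1); last by lia.
  congr (_ && _); apply: eq_forallb => k; have kr := ltn_ord k.
  by rewrite nE ?ifF ?eqSS ?addnBAC; lia.
apply/negbTE/negP => /andP[desc /forallP flat].
have pos i : i < size s -> 0 < nth 0 s i by apply: nth_gt0.
case: (ltnP j p) => jp'.
  have kr : p - j < r by lia.
  have := flat (Ordinal kr); rewrite /= !nE; [|lia..].
  rewrite subnKC ?ltnn; last by lia.
  rewrite (_ : p < p + r) ?jp'; last by lia.
  by have := pos j; lia.
have [e1 e2 e3] : [/\ (j < p) = false, (j.-1 < p) = false & j.-1 < p + r] by split; lia.
by move: desc; rewrite !nE ?e1 ?e2 ?e3; [case: ifP|lia..].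
Qed.

Lemma MAJ_insert_min r n p (s : seq nat) : 0 < r -> 0 \notin s ->
  size s = r * n -> p <= r * n ->
  MAJ r n.+1 (insert_min r p s) =
    p + \sum_(1 <= j < (r * (n - 1)).+1 | Jpos r s j)
          (j * (j + r <= p) + (j + r) * (p < j)).
Proof.
move=> r0 s0 zs pn; rewrite /MAJ subn1 /=.
rewrite big_mkcond (eq_big_nat _ _ (F2 := fun j => (if j == p then p else 0) +
  ((if (j + r <= p) && Jpos r s j then j else 0) +
   (if (p + r < j) && Jpos r s (j - r) then j else 0)))); last first.
  move=> j /andP[j0 jn]; rewrite Jpos_insert_min ?zs //.
  case: eqVneq => [->|_] /=; first by rewrite !ifF ?addn0; lia.
  case: (leqP (j + r) p) => jp /=; last by rewrite add0n.
  by rewrite ltnNge (_ : j <= p + r) ?orbF ?addn0 //=; lia.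
rewrite !big_split /=; congr (_ + _).
  rewrite -big_mkcond /= big_nat1_eq; case: ifP => //; lia.
case: n => [|n'] in zs pn *; first by rewrite !big_geq ?muln0.
rewrite mulnS /= in pn *; set K := r * n' in pn *.
rewrite (@big_cat_nat _ _ _ K.+1) ?ltnS ?leq_addl //=.
rewrite [X in _ + X + _]big_nat_cond [X in _ + X + _]big1 ?addn0; last first.
  by move=> j /andP[/andP[Kj _] _]; rewrite (_ : (j + r <= p) = false) //; lia.
rewrite [X in _ + X](@big_cat_nat _ _ _ r.+1) ?ltnS ?leq_addr //=.
rewrite [X in _ + (X + _)]big_nat_cond [X in _ + (X + _)]big1 ?add0n; last first.
  by move=> j /andP[/andP[_ jr] _]; rewrite (_ : (p + r < j) = false) //; lia.
rewrite [n'.+1 - 1]subn1 /= -/K -[r.+1]add1n big_addn -addnS addKn.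
rewrite -!big_split [RHS]big_mkcond.
apply: eq_bigr => j _ /=; rewrite addnK addnC ltn_add2r.
by case: (Jpos r s j); rewrite ?andbT ?andbF //; do 2! case: ifP; lia.
Qed.

Lemma sum_qint a b : (\sum_(a <= e < a + b) 'X^e = 'X^a * qint b :> {poly int})%R.
Proof.
rewrite /qint mulr_sumr -{1}[a]add0n big_addn addKn big_mkord.
by apply: eq_bigr => i _; rewrite addnC exprD.
Qed.

Section InsertionInterval.

(** [J] stands for the counted positions of a word, all at most [K]. *)
Variables (r K : nat) (J : pred nat).
Hypothesis r0 : 0 < r.
Hypothesis gap : forall i j, 0 < i -> J i -> J j -> i < j -> i + r <= j.

(** The major index after an insertion at [p], as given by [MAJ_insert_min]. *)
Let mu p := p + \sum_(1 <= j < K.+1 | J j) (j * (j + r <= p) + (j + r) * (p < j)).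

(** The start of the interval of values produced by the places below [q], when
    [q] cuts no window. *)
Let W q := \sum_(1 <= j < K.+1 | J j) (j + r * (q <= j)).

(** [q] lies strictly inside no window. *)
Let clean q := forall j, 0 < j -> j <= K -> J j -> (j + r <= q) || (q <= j).

Lemma big_isolate j (f : nat -> nat) : 0 < j -> j <= K -> J j ->
  \sum_(1 <= i < K.+1 | J i) f i = f j + \sum_(1 <= i < K.+1 | J i && (i != j)) f i.
Proof.
move=> j0 jK Jj; rewrite (bigID (pred1 j)) /=; congr (_ + _).
rewrite (eq_bigl (pred1 j)) => [|i]; first by rewrite big_nat1_eq j0 ltnS jK.
by rewrite /=; case: eqVneq => [->|]; rewrite ?Jj ?andbF.
Qed.

Lemma eq_bigJ (P : pred nat) (f g : nat -> nat) :
  (forall i, 0 < i -> i <= K -> J i -> P i -> f i = g i) ->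
  \sum_(1 <= i < K.+1 | J i && P i) f i = \sum_(1 <= i < K.+1 | J i && P i) g i.
Proof.
move=> fg; rewrite big_nat_cond [RHS]big_nat_cond; apply: eq_bigr => i.
by rewrite ltnS => /and3P[/andP[i0 iK] Ji Pi]; apply: fg.
Qed.

(** The induction runs backwards over clean places: if a window ends at [q.+1],
    it is removed as a whole, since its left end is the next clean place below;
    otherwise [q] is clean and belongs to no window. *)
Lemma insertion_interval q : clean q ->
  (\sum_(0 <= p < q) 'X^(mu p) = \sum_(W q <= e < W q + q) 'X^e :> {poly int})%R.
Proof.
elim/ltn_ind: q => [[|q]] IH cl; first by rewrite !big_geq ?addn0.
case: (boolP [&& r <= q, J (q.+1 - r) & q.+1 - r <= K]) => [/and3P[rq Jj jK]|nJ].
  set j := q.+1 - r in Jj jK.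
  have eq : q.+1 = j + r by rewrite /j; lia.
  have j0 : 0 < j by lia.
  have far i : 0 < i -> J i -> i != j -> (i + r <= j) || (j + r <= i).
    move=> i0 Ji; case: (ltngtP i j) => // ij _; first by rewrite gap.
    by rewrite orbC gap.
  have clj : clean j.
    move=> i i0 iK Ji; case: (eqVneq i j) => [->|ij]; first by rewrite leqnn orbT.
    by case/orP: (far i i0 Ji ij); lia.
  (* Crossing the window lowers the start of the interval by [r] ... *)
  have Wj : W j = W (j + r) + r.
    rewrite /W !(big_isolate j) // leqnn muln1 (_ : (j + r <= j) = false); last by lia.
    rewrite muln0 addn0 addnAC; congr (_ + _ + _); apply: eq_bigJ => i i0 iK Ji ij.
    by congr (_ + r * nat_of_bool _); have := far i i0 Ji ij; lia.
  (* ... and its [r] places produce exactly the [r] new values. *)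
  have muj i : i < r -> mu (i + j) = W (j + r) + i.
    move=> ir; rewrite /mu /W !(big_isolate j) //.
    have [-> -> ->] : [/\ (j + r <= i + j) = false, (i + j < j) = false
      & (j + r <= j) = false] by split; lia.
    rewrite !muln0 !addn0 add0n [RHS]addnAC [i + j]addnC; congr (_ + _).
    apply: eq_bigJ => a a0 aK Ja aj; rewrite /=; case/orP: (far a a0 Ja aj) => h.
      have [-> -> ->] : [/\ a + r <= j + i, (j + i < a) = false & (j + r <= a) = false].
        by split; lia.
      by rewrite muln1 !muln0.
    have [-> -> ->] : [/\ (a + r <= j + i) = false, j + i < a & j + r <= a].
      by split; lia.
    by rewrite !muln1 muln0.
  rewrite eq (@big_cat_nat _ _ _ j) ?leq_addr //= IH //; last by lia.
  rewrite [RHS](@big_cat_nat _ _ _ (W (j + r) + r)) ?leq_add2l ?leq_addl ?leq_addr //=.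
  rewrite addrC Wj -addnA [r + j]addnC; congr (_ + _)%R.
  rewrite -{1}[j]add0n big_addn addKn -{1}[W _]add0n big_addn addKn.
  by apply: eq_big_nat => i /andP[_ ir]; rewrite muj // addnC.
have nJq : ~~ (J q && (0 < q <= K)).
  apply/negP => /andP[Jq /andP[q0 qK]].
  case/orP: (cl q q0 qK Jq) => h; last by lia.
  have r1 : r = 1 by lia.
  by rewrite r1 subn1 /= Jq qK q0 in nJ.
have clq : clean q.
  move=> i i0 iK Ji; case/orP: (cl i i0 iK Ji) => h; last by rewrite (ltnW h) orbT.
  case: (eqVneq (i + r) q.+1) => [e|]; last by lia.
  by move: nJ; rewrite -e addnK Ji iK; lia.
have lec i : 0 < i -> i <= K -> J i -> (q <= i) = (q < i).
  by move=> i0 iK Ji; rewrite leq_eqVlt; case: eqVneq => // e; move: nJq; rewrite e Ji i0 iK.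
(* A place outside the windows appends one value at the top. *)
have [Wq muq] : W q.+1 = W q /\ mu q = W q + q.
  split; rewrite /mu /W.
    rewrite big_nat_cond [RHS]big_nat_cond; apply: eq_bigr => i.
    by rewrite ltnS => /andP[/andP[i0 iK] Ji]; rewrite lec.
  rewrite addnC; congr (_ + _); rewrite big_nat_cond [RHS]big_nat_cond.
  apply: eq_bigr => i; rewrite ltnS => /andP[/andP[i0 iK] Ji]; rewrite lec //.
  have := clq i i0 iK Ji; rewrite lec // => /orP h.
  case: (ltnP q i) h => qi h; last by rewrite !muln0 !addn0; case: h => // ->; rewrite muln1.
  by rewrite (_ : (i + r <= q) = false) ?muln0 ?muln1 //; lia.
rewrite big_nat_recr //= IH // Wq muq addnS [RHS]big_nat_recr //=; last by rewrite leq_addr.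
Qed.

End InsertionInterval.

Lemma sum_INV_insert_min r n s : 0 < r -> s \in stirling_perms r n ->
  (\sum_(0 <= p < (r * n).+1) 'X^(INV r (insert_min r p s))
    = 'X^(INV r s) * qint (n * r + 1) :> {poly int})%R.
Proof.
move=> r0 /mem_stirling_perms[s0 zs _].
rewrite addn1 mulnC /qint mulr_sumr big_mkord; apply: eq_bigr => p _.
have ps : p <= size s by rewrite zs [r * n]mulnC -ltnS.
by rewrite /INV inv_insert_min // divnMDl // addnC exprD.
Qed.

Lemma sum_MAJ_insert_min r n s : 0 < r -> s \in stirling_perms r n ->
  (\sum_(0 <= p < (r * n).+1) 'X^(MAJ r n.+1 (insert_min r p s))
    = 'X^(MAJ r n s) * qint (n * r + 1) :> {poly int})%R.
Proof.
move=> r0 /mem_stirling_perms[s0 zs _].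
under eq_big_nat => p pn do rewrite (MAJ_insert_min r n p s r0 s0 zs) //.
have n0 : r * (n - 1) + r <= r * n \/ n = 0.
  by case: n {zs} => [|n]; [right|left; rewrite subn1 mulnS addnC].
(* The last place [(r * n).+1] is clean, every window ending at most at [r * n]. *)
rewrite insertion_interval //; last 2 first.
- by move=> i j i0 Ji Jj ij; apply: (Jpos_gap _ s) => //; apply: leq_trans ij.
- move=> j j0 jK _; case: n0 jK => [|->]; lia.
rewrite (_ : \sum_(_ <= j < _ | _) _ = MAJ r n s); last first.
  rewrite /MAJ big_nat_cond [RHS]big_nat_cond; apply: eq_bigr => j.
  rewrite ltnS => /andP[/andP[j0 jK] _]; rewrite ltnNge (_ : j <= r * n) ?muln0 ?addn0 //.
  by case: n0 jK => [|->]; lia.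
by rewrite sum_qint mulnC addn1.
Qed.

Local Open Scope ring_scope.

Theorem theorem3p10 (r n : nat) (hr : (1 <= r)%N) (hn : (1 <= n)%N) :
  \sum_(nu <- stirling_perms r n) 'X^(INV r nu)
    = \sum_(nu <- stirling_perms r n) 'X^(MAJ r n nu) :> {poly int}
  /\ \sum_(nu <- stirling_perms r n) 'X^(MAJ r n nu)
    = \prod_(1 <= i < n) qint (i * r + 1) :> {poly int}.
Proof.
have INV_prod := insertion_statistic r (fun=> INV r) hr _ _ n.
have MAJ_prod := insertion_statistic r (MAJ r) hr _ _ n.
rewrite INV_prod; last 2 first.
- by rewrite /INV invE div0n.
- by move=> m s; apply: sum_INV_insert_min.
rewrite MAJ_prod; last 2 first.
- by rewrite /MAJ muln0 big_geq.
- by move=> m s; apply: sum_MAJ_insert_min.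
split=> //; rewrite big_ltn //.
by rewrite mul0n add0n /qint big_ord1 expr0 mul1r.
Qed.
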